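(* Let $H=(V,S)$ be a signed hypergraph of rank $r$ whose underlying hypergraph is $\beta$-acyclic. Then the pseudo-Boolean polytope $\mathcal P_{pB}(H)$ has a polynomial-size extended formulation with at most $2r(2|S|+1)|V|$ variables and at most $4r(2|S|+1)|V|$ inequalities. Moreover, all coefficients and right-hand side constants in the system defining $\mathcal P_{pB}(H)$ (i.e., in this extended formulation) are $0,\pm 1$.
   Context: A hypergraph is a pair $(V,E)$ with $V$ a finite set of nodes and $E$ a set of edges, which are subsets of $V$ of cardinality at least two. A signed hypergraph $H$ is a pair $(V,S)$ with $V$ a finite set of nodes and $S$ a set of signed edges. A signed edge is a pair $s=(e,\eta_s)$ with $e\subseteq V$, $|e|\ge 2$, and $\eta_s:e\to\{-1,+1\}$; $e$ is its underlying edge. No two signed edges of $S$ are identical (same $e$ and same $\eta_s$), but signed edges may be parallel (same $e$). Set-theoretic notation for $s$ refers to its underlying edge. The underlying hypergraph of $H$ is obtained by ignoring signs and dropping parallel edges. The rank of a (signed) hypergraph is the maximum cardinality of any of its (signed) edges. For a hypergraph $G=(V,E)$ and $v\in V$, $G-v$ is the hypergraph with node set $V\setminus\{v\}$ and edge set $\{e\setminus\{v\}: e\in E,\ |e\setminus\{v\}|\ge 1\}$. A node $v$ is a $\beta$-leaf of $G$ if the set of edges of $G$ containing $v$ is totally ordered by inclusion. $G$ is $\beta$-acyclic if there is an ordering $v_1,\dots,v_n$ of all its nodes ($n=|V|$) such that $v_1$ is a $\beta$-leaf of $G$, $v_2$ is a $\beta$-leaf of $G-v_1$, and so on, until $v_n$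 is a $\beta$-leaf of $G-v_1-\cdots-v_{n-1}$. For a signed edge $s$ and $v\in s$, let $\sigma_s(z_v):=z_v$ if $\eta_s(v)=+1$ and $\sigma_s(z_v):=1-z_v$ if $\eta_s(v)=-1$. The pseudo-Boolean set is $\mathcal S_{pB}(H):=\{z\in\{0,1\}^{V\cup S}: z_s=\prod_{v\in s}\sigma_s(z_v)\ \forall s\in S\}$, and the pseudo-Boolean polytope $\mathcal P_{pB}(H)$ is its convex hull. An extended formulation of $\mathcal P_{pB}(H)$ is a finite system of linear inequalities and equalities in variables $(z,y)$, with $z$ indexed by $V\cup S$ and $y$ a vector of additional variables, whose solution set projects onto $\mathcal P_{pB}(H)$ in the $z$-space. The number of variables counts all variables $(z,y)$. It is polynomial-size if its number of variables and constraints is bounded by a polynomial in $|V|,|S|$. *)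

(* Defs.v *)
From mathcomp Require Import all_boot all_order all_algebra.

Set Implicit Arguments.
Unset Strict Implicit.
Unset Printing Implicit Defensive.

Import Order.TTheory GRing.Theory Num.Theory.

Local Open Scope ring_scope.

(* Nodes live in an ambient finite type T, so that deleting nodes does not
   change the type.  Edges of cardinality one are allowed because node deletion
   may create them; the underlying hypergraphs considered below have only edges
   of cardinality at least two. *)
Record hypergraph (T : finType) := Hypergraph {
  nodes : {set T};
  edges : {set {set T}};
  edges_wf : [forall e in edges, (e \subset nodes) && (0 < #|e|)%N] }.

Section BetaAcyclicity.
Variable T : finType.
Implicit Type G : hypergraph T.

Definition del_edges G (v : T) : {set {set T}} :=
  [set e :\ v | e : {set T} in edges G & (0 < #|e :\ v|)%N].

Fact del_edges_wf G v :
  [forall f in del_edges G v, (f \subset nodes G :\ v) && (0 < #|f|)%N].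
Proof.
apply/forall_inP=> _ /imsetP[e /[!inE] /andP[eG e_gt0] ->].
have /andP[eV _] := forall_inP (edges_wf G) e eG.
by rewrite setSD.
Qed.

Definition del_node G v : hypergraph T := Hypergraph (del_edges_wf G v).

Definition beta_leaf G (v : T) : bool :=
  (v \in nodes G) &&
  [forall e in edges G, forall f in edges G,
     (v \in e) && (v \in f) ==> (e \subset f) || (f \subset e)].

Fixpoint beta_elimination G (vs : seq T) : bool :=
  if vs is v :: vs' then beta_leaf G v && beta_elimination (del_node G v) vs'
  else true.

Definition beta_acyclic G : Prop :=
  exists2 vs : seq T, perm_eq vs (enum (nodes G)) & beta_elimination G vs.

End BetaAcyclicity.

(* The pair (e, eta) with eta : e -> {-1, +1}; the sign +1 is encoded by true
   and -1 by false.  As eta is only defined on e, equality in this type is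
   exactly equality of the edge and of the signs. *)
Definition signed_edge (V : finType) : finType :=
  {e : {set V} & {ffun {v : V | v \in e} -> bool}}.

Definition edge_of (V : finType) (s : signed_edge V) : {set V} := tag s.

Definition sign_of (V : finType) (s : signed_edge V) :
  {ffun {v : V | v \in edge_of s} -> bool} := tagged s.

(* The node set is the whole finite type V. *)
Record signed_hypergraph (V : finType) := SignedHypergraph {
  sedges : {set signed_edge V};
  sedges_wf : [forall s in sedges, (2 <= #|edge_of s|)%N] }.

Section SignedHypergraph.
Variables (V : finType) (H : signed_hypergraph V).

Definition underlying_edges : {set {set V}} :=
  [set edge_of s | s in sedges H].

Fact underlying_edges_wf :
  [forall e in underlying_edges, (e \subset [set: V]) && (0 < #|e|)%N].
Proof.
apply/forall_inP=> _ /imsetP[s sH ->]; rewrite subsetT /=.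
exact: ltnW (forall_inP (sedges_wf H) s sH).
Qed.

Definition underlying : hypergraph V := Hypergraph underlying_edges_wf.

(* A maximum over an empty set does not exist: there is no rank when there are
   no signed edges. *)
Definition has_rank (r : nat) : Prop :=
  (exists2 s, s \in sedges H & #|edge_of s| = r) /\
  (forall s, s \in sedges H -> (#|edge_of s| <= r)%N).

(* The disjoint union of V and S, indexing the coordinates z. *)
Definition pb_index : finType := (V + {s : signed_edge V | s \in sedges H})%type.

Variable R : realFieldType.

Definition literal (s : signed_edge V) (z : V -> R)
    (v : {v : V | v \in edge_of s}) : R :=
  if sign_of s v then z (val v) else 1 - z (val v).

Definition pseudo_boolean_set (z : {ffun pb_index -> R^o}) : Prop :=
  (forall i, z i = 0 \/ z i = 1) /\
  (forall s : {s : signed_edge V | s \in sedges H},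
     z (inr s) =
     \prod_(v : {v : V | v \in edge_of (val s)})
        literal (fun u => z (inl u)) v).

End SignedHypergraph.

Definition convex_hull (R : numDomainType) (E : lmodType R) (A : E -> Prop)
    (x : E) : Prop :=
  exists (n : nat) (w : 'I_n -> R) (u : 'I_n -> E),
    [/\ forall i, 0 <= w i, \sum_i w i = 1, forall i, A (u i)
      & x = \sum_i w i *: u i].

Definition pseudo_boolean_polytope (V : finType) (H : signed_hypergraph V)
    (R : realFieldType) : {ffun pb_index H -> R^o} -> Prop :=
  convex_hull (@pseudo_boolean_set V H R).

(* The constraint (a, b) stands for a x <= b among the inequalities, and for
   a x = b among the equalities. *)
Definition lin_constraint (R : realFieldType) (X : finType) : Type :=
  ({ffun X -> R} * R)%type.

Record lin_system (R : realFieldType) (X : finType) := LinSystem {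
  ineqs : seq (lin_constraint R X);
  eqns : seq (lin_constraint R X) }.

Section LinSystem.
Variables (R : realFieldType) (X : finType).
Implicit Types (F : lin_system R X) (c : lin_constraint R X).

Definition lin_form (a : {ffun X -> R}) (x : {ffun X -> R^o}) : R :=
  \sum_i a i * x i.

Definition solution F (x : {ffun X -> R^o}) : Prop :=
  (forall c, c \in ineqs F -> lin_form c.1 x <= c.2) /\
  (forall c, c \in eqns F -> lin_form c.1 x = c.2).

Definition n_constraints F : nat := size (ineqs F) + size (eqns F).

Definition in_0_pm1 (t : R) : bool := t \in [:: 0; 1; -1].

Definition data_0_pm1 F : Prop :=
  forall c, c \in ineqs F ++ eqns F ->
    (forall i, in_0_pm1 (c.1 i)) /\ in_0_pm1 c.2.

End LinSystem.

(* I indexes the original variables z, Y the additional variables y. *)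
Definition extended_formulation (R : realFieldType) (I Y : finType)
    (F : lin_system R (I + Y)%type) (P : {ffun I -> R^o} -> Prop) : Prop :=
  forall z : {ffun I -> R^o},
    P z <->
    exists2 x : {ffun (I + Y)%type -> R^o},
      solution F x & forall i, x (inl i) = z i.

(* Main.v *)
Require Import Defs.
From mathcomp Require Import all_boot all_order all_algebra.
From mathcomp Require Import zify.

(** Every coordinate of the pseudo-Boolean set is the indicator of a cube: the
    set of 0/1 points agreeing with a partial assignment of the nodes (one
    positive literal for the coordinate of a node, the literals of s for the
    coordinate of a signed edge s).  A point of the polytope is thus a vector of
    cube probabilities under some distribution of the nodes, and the formulation
    describes how such a distribution can be generated node by node, against the
    elimination order.

    Let v be a node and consider the cubes fixing v.  Cut down to the nodes
    eliminated after v, their supports form a chain, because v is a beta-leaf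
    when its turn comes; hence any two of these tails are disjoint or nested as
    sets of points (the [atoms] at v, to which the empty assignment is added).
    Every point has a finest atom containing it, its [state] at v.  The
    additional variables a(v, t, b) stand for the probability that the state at
    v is t and the value of v is b.  The probability of an atom, or of any of
    the given cubes, is read off in two ways:
    - as the sum of a(v, t', b) over b and the atoms t' refining t, if t is an
      atom at v;
    - as the sum of a(u, t', b) over the atoms t' at u refining the tail of the
      cube, if u is its first node and b the value it prescribes there; the empty
      assignment has probability 1.
    The equations identify both readings for atoms, and the second reading with
    the coordinate z for the given cubes; the inequalities are a >= 0.

    True distributions clearly satisfy these constraints
    ([cube_weight_state], [state_weight_consistent]).  Conversely, solutions come
    from distributions ([consistent_realizable]): proceed backwards in
    the elimination order, and resample v conditionally on its state, in the
    proportions given by a(v, t, true) and a(v, t, false) ([resample]).  The law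
    of the state at that moment has the right marginals because it is determined
    by the probabilities of the atoms, by inversion along refinement
    ([eq_of_down_sums]).  This conditional independence is what makes the local
    constraints at the different nodes glue together.

    There is at most one atom per signed edge at v, plus the empty assignment, so
    the numbers of variables and constraints are of order |V| (|S| + 1), and all
    data are 0 or 1 or -1 because each constraint compares two plain sums of
    variables. *)

Set Implicit Arguments.
Unset Strict Implicit.
Unset Printing Implicit Defensive.

Import Order.TTheory GRing.Theory Num.Theory.

Local Open Scope ring_scope.

(** * Inversion of sums over the elements below a given one *)

(** Strong induction along the order: the sums over the elements strictly below
    t agree by induction, so the remaining terms at t agree. *)
Lemma eq_of_down_sums (T : finType) (U : zmodType) (le : rel T) (A : {set T})
    (f g : T -> U) :
    reflexive le -> antisymmetric le -> transitive le ->
    {in A, forall t, \sum_(t' in A | le t' t) f t' =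
                     \sum_(t' in A | le t' t) g t'} ->
  {in A, f =1 g}.
Proof.
move=> le_refl le_asym le_trans eq_sums t.
have [n] := ubnP #|[set t' in A | le t' t]|; elim: n t => // n IHn t lt_n tA.
have tt : (t \in A) && le t t by rewrite tA le_refl.
have := eq_sums t tA; rewrite (bigD1 t tt) [RHS](bigD1 t tt) /=.
have -> : \sum_(t' | (t' \in A) && le t' t && (t' != t)) f t' =
          \sum_(t' | (t' \in A) && le t' t && (t' != t)) g t'.
  apply: eq_bigr => t' /andP[/andP[t'A le_t't] neq_t't]; apply: IHn => //.
  rewrite -ltnS; apply: leq_trans lt_n; rewrite ltnS; apply: proper_card.
  apply/properP; split.
    apply/subsetP=> u /[!inE] /andP[-> /=] le_ut'; exact: le_trans le_t't.
  exists t; rewrite !inE tA ?le_refl //=; apply: contra neq_t't => le_tt'.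
  by apply/eqP/le_asym; rewrite le_t't.
exact: addIr.
Qed.

(** * Cubes: partial assignments of the nodes *)

Section Cubes.
Variable V : finType.

Definition point : finType := {ffun V -> bool}.
Definition cube : finType := {ffun V -> option bool}.

Implicit Types (w : point) (c d t : cube) (v : V).

Definition satisfies w c := [forall v, c v ==> (c v == Some (w v))].
Definition refines t c := [forall v, c v ==> (t v == c v)].
Definition supp c : {set V} := [set v | c v].
Definition cube0 : cube := [ffun=> None].
Definition update w v b : point := [ffun u => if u == v then b else w u].

Lemma supp_cube0 : supp (cube0) = set0.
Proof. by apply/setP=> v; rewrite !inE ffunE. Qed.

Lemma satisfiesP w c :
  reflect (forall v b, c v = Some b -> w v = b) (satisfies w c).
Proof.
apply: (iffP forallP) => [satisfies_wc v b cv | satisfies_wc v].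
  by have := satisfies_wc v; rewrite cv /= => /eqP[].
by case Ecv: (c v) => [b|] //=; rewrite (satisfies_wc v b).
Qed.

Lemma refinesP t c :
  reflect (forall v b, c v = Some b -> t v = Some b) (refines t c).
Proof.
apply: (iffP forallP) => [ref_tc v b cv | ref_tc v].
  by have := ref_tc v; rewrite cv /= => /eqP.
by case Ecv: (c v) => [b|] //=; rewrite (ref_tc v b).
Qed.

Lemma refines_refl : reflexive refines.
Proof. by move=> c; apply/refinesP. Qed.

Lemma refines_trans : transitive refines.
Proof.
move=> d t c /refinesP td /refinesP dc.
by apply/refinesP=> v b /dc /td.
Qed.

Lemma refines_antisym : antisymmetric refines.
Proof.
move=> c d /andP[/refinesP cd /refinesP dc]; apply/ffunP=> v.
case Ed: (d v) => [b|]; first exact: cd.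
by case Ec: (c v) => [b|] //; move/dc: Ec; rewrite Ed.
Qed.

Lemma satisfies_refines w t c : refines t c -> satisfies w t -> satisfies w c.
Proof.
move=> /refinesP tc /satisfiesP wt; apply/satisfiesP=> v b /tc; exact: wt.
Qed.

(** Both cubes agree with w wherever they are defined, hence with each other;
    among cubes with nested supports, meeting at a point forces refinement. *)
Lemma satisfies_nested w t c :
  satisfies w t -> satisfies w c -> supp c \subset supp t -> refines t c.
Proof.
move=> /satisfiesP wt /satisfiesP wc /subsetP sub_ct; apply/refinesP=> v b cv.
have: v \in supp t by apply: sub_ct; rewrite inE cv.
by rewrite inE; case Et: (t v) => [b'|] // _; rewrite -(wt _ _ Et) -(wc _ _ cv).
Qed.

Lemma satisfies_cube0 w : satisfies w cube0.
Proof. by apply/satisfiesP=> v b; rewrite ffunE. Qed.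

Lemma satisfies_update w v b c :
  ~~ c v -> satisfies (update w v b) c = satisfies w c.
Proof.
move=> cv; apply: eq_forallb => u; rewrite ffunE.
by case: (u =P v) => // ->; rewrite (negPf cv).
Qed.

End Cubes.
Arguments cube0 {V}.

(** * Finite probability and resampling of one coordinate *)

Section Probability.
Variable R : realFieldType.

Definition Pr (T : finType) (mu : T -> R) (E : pred T) : R :=
  \sum_(x | E x) mu x.

Definition distribution (T : finType) (mu : T -> R) : Prop :=
  (forall x, 0 <= mu x) /\ Pr mu predT = 1.

Lemma eq_Pr (T : finType) (mu : T -> R) (E E' : pred T) :
  E =1 E' -> Pr mu E = Pr mu E'.
Proof. exact: eq_bigl. Qed.

Lemma Pr_ge0 (T : finType) (mu : T -> R) E :
  (forall x, 0 <= mu x) -> 0 <= Pr mu E.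
Proof. by move=> mu_ge0; apply: sumr_ge0. Qed.

Lemma Pr_partition (T S : finType) (mu : T -> R) (L : T -> S) (A : {set S})
    (E : pred T) (P : pred S) :
    (forall x, L x \in A) ->
  Pr mu (fun x => E x && P (L x)) =
  \sum_(t in A | P t) Pr mu (fun x => E x && (L x == t)).
Proof.
move=> LA; rewrite /Pr (partition_big L (fun t => (t \in A) && P t)) /=.
  apply: eq_bigr => t /andP[_ Pt]; apply: eq_bigl => x.
  by case: (L x =P t) => [->|]; rewrite ?Pt ?andbT ?andbF.
by move=> x /andP[_ ->]; rewrite LA.
Qed.

(** Keep the coordinates other than v, and redraw v with conditional law
    g(t, b) / Pr(L = t) given L = t.  As L does not see v, the law of everything
    not depending on v is unchanged, while the joint law of L and v becomes g. *)
Lemma resample (V T : finType) (mu : point V -> R) (v : V) (L : point V -> T)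
    (A : {set T}) (g : T -> bool -> R) :
    (forall w, 0 <= mu w) -> (forall t b, 0 <= g t b) ->
    (forall w, L w \in A) -> (forall w b, L (update w v b) = L w) ->
    {in A, forall t, Pr mu (fun w => L w == t) = g t true + g t false} ->
  exists mu' : point V -> R, [/\ forall w, 0 <= mu' w,
    forall E : pred (point V), (forall w b, E (update w v b) = E w) ->
      Pr mu' E = Pr mu E
    & {in A, forall t b, Pr mu' (fun w => (w v == b) && (L w == t)) = g t b}].
Proof.
move=> mu_ge0 g_ge0 LA Lv Pr_L.
(* [k w b] is the mass sent from [w] to [update w v b]. *)
pose k w b := mu w * (g (L w) b / Pr mu (fun w' => L w' == L w)).
pose f (p : point V * bool) := update p.1 v p.2.
pose mu' w := \sum_(p | f p == w) k p.1 p.2.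
have k_sum w : k w true + k w false = mu w.
  rewrite -mulrDr -mulrDl -Pr_L //.
  (* A state of probability zero divides by zero, but then [mu w] is zero. *)
  have [Pr0|Pr_neq0] := eqVneq (Pr mu (fun w' => L w' == L w)) 0; last first.
    by rewrite divff ?mulr1.
  move/psumr_eq0P: (Pr0) => /= ->; rewrite ?eqxx ?mul0r // => *; exact: mu_ge0.
have Pr_mu' E : Pr mu' E = \sum_w \sum_(b | E (update w v b)) k w b.
  rewrite pair_big_dep /= /Pr (partition_big f E) //=.
  apply: eq_bigr => w Ew; apply: eq_bigl => p.
  by rewrite -/(f p); case: eqP => [->|]; rewrite ?Ew ?andbF.
exists mu'; split=> [w|E Ev|t tA b].
- apply: sumr_ge0 => p _; rewrite mulr_ge0 ?divr_ge0 //; exact: Pr_ge0.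
- rewrite Pr_mu' /Pr [RHS]big_mkcond; apply: eq_bigr => w _ /=.
  under eq_bigl do rewrite Ev; case: (E w); last by rewrite big_pred0.
  by rewrite big_bool /= k_sum.
rewrite Pr_mu'; transitivity (\sum_(w | L w == t) k w b).
  rewrite [RHS]big_mkcond; apply: eq_bigr => w _.
  under eq_bigl do rewrite Lv ffunE eqxx.
  case: eqP => _; last by rewrite big_pred0 // => b'; rewrite andbF.
  by rewrite (big_pred1 b) // => b'; rewrite andbT.
transitivity (Pr mu (fun w => L w == t) * (g t b / Pr mu (fun w => L w == t))).
  by rewrite mulr_suml; apply: eq_bigr => w /eqP <-.
rewrite mulrC; have [Pr0|] := eqVneq (Pr mu (fun w => L w == t)) 0; last first.
  by move=> ?; rewrite divfK.
have /eqP := Pr_L t tA; rewrite Pr0 mulr0 eq_sym paddr_eq0 // => /andP[].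
by move=> /eqP g_true /eqP g_false; case: b; rewrite ?g_true ?g_false.
Qed.

End Probability.
(** * Chained families of cubes and the states they define *)

Section CubeFamily.
Variables (V I : finType) (pos : V -> nat) (q : I -> cube V).
Hypothesis pos_inj : injective pos.

Implicit Types (w : point V) (c d t : cube V) (u v : V).

Definition tail v c : cube V :=
  [ffun u => if (pos v < pos u)%N then c u else None].
Definition first c v := c v && [forall u, c u ==> (pos v <= pos u)%N].
(** The empty assignment is always included: it gives a state to the points
    meeting none of the other cubes, and carries the total mass. *)
Definition atoms v : {set cube V} :=
  cube0 |: [set tail v (q i) | i : I & q i v].

Definition atom_pairs : {set V * cube V} := [set p | p.2 \in atoms p.1].

Lemma first_uniq c u v : first c u -> first c v -> u = v.
Proof.
case/andP=> cu /forallP min_u /andP[cv /forallP min_v]; apply: pos_inj.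
by apply/eqP; rewrite eqn_leq (implyP (min_u v)) // (implyP (min_v u)).
Qed.

Lemma first_cube0 v : ~~ first cube0 v.
Proof. by rewrite /first ffunE. Qed.

Lemma cube0_or_first c :
  c = cube0 \/ exists2 v, first c v & exists b, c v = Some b.
Proof.
have [c0|/existsP[u /negbNE cu]] := boolP [forall u, ~~ c u].
  left; apply/ffunP=> u; rewrite ffunE.
  by have := forallP c0 u; case: (c u).
right; case: (@arg_minnP _ u (fun u => c u) pos cu) => v cv min_v.
exists v; last by case: (c v) cv => // b _; exists b.
by rewrite /first cv; apply/forallP=> x; apply/implyP/min_v.
Qed.

Lemma tail_self v c : ~~ tail v c v.
Proof. by rewrite ffunE ltnn. Qed.

Lemma atoms_self v t : t \in atoms v -> ~~ t v.
Proof. by case/setU1P=> [->|/imsetP[i _ ->]]; rewrite ?tail_self ?ffunE. Qed.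

Lemma tail_tail u v c : (pos u < pos v)%N -> tail v (tail u c) = tail v c.
Proof.
move=> lt_uv; apply/ffunP=> x; rewrite !ffunE.
by case: ifP => // /(ltn_trans lt_uv) ->.
Qed.

(** A cube splits into its value at its first node and its tail, as nothing in
    it is eliminated earlier. *)
Lemma satisfies_first w v c b : first c v -> c v = Some b ->
  satisfies w c = satisfies w (tail v c) && (w v == b).
Proof.
case/andP=> _ /forallP min_v cv.
apply/idP/andP=> [/satisfiesP wc | [/satisfiesP wt /eqP wv]].
  split; last by rewrite (wc v b).
  by apply/satisfiesP=> u b'; rewrite ffunE; case: ifP => // _; apply: wc.
apply/satisfiesP=> u b' cu; have := min_v u.
rewrite cu /= leq_eqVlt => /predU1P[/pos_inj eq_vu|lt_vu].
  by move: cu; rewrite -eq_vu cv => -[<-].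
by apply: wt; rewrite ffunE lt_vu.
Qed.

(** The cubes whose probability can be read off the weights at their first
    node.  Atoms are admissible as well as the given cubes, which makes the
    readings recursive. *)
Definition admissible c := [forall v, first c v ==> (tail v c \in atoms v)].

Lemma admissible_family i : admissible (q i).
Proof.
apply/forallP=> v; apply/implyP=> /andP[qv _]; apply/setU1P; right.
by apply: imset_f; rewrite inE.
Qed.

Lemma admissible_atom v t : t \in atoms v -> admissible t.
Proof.
move=> tv; apply/forallP=> u; apply/implyP=> /andP[tu _].
case/setU1P: tv tu => [->|/imsetP[i _ ->]]; rewrite ffunE //.
case: ifP => // lt_vu qu; rewrite tail_tail //.
by apply/setU1P; right; apply: imset_f; rewrite inE.
Qed.

Hypothesis nested : forall v i j, q i v -> q j v ->
  (supp (tail v (q i)) \subset supp (tail v (q j))) ||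
  (supp (tail v (q j)) \subset supp (tail v (q i))).

Lemma atoms_nested v t t' : t \in atoms v -> t' \in atoms v ->
  (supp t \subset supp t') || (supp t' \subset supp t).
Proof.
case/setU1P=> [->|/imsetP[i /[!inE] qiv ->]].
  by rewrite supp_cube0 sub0set.
case/orP=> [/eqP->|/imsetP[j /[!inE] qjv ->]]; last exact: nested.
by rewrite supp_cube0 sub0set orbT.
Qed.

(** The finest atom met by w; ties do not matter, as atoms met by the same
    point are determined by their supports. *)
Definition state v w : cube V :=
  [arg max_(t > cube0 | (t \in atoms v) && satisfies w t) #|supp t|]%N.

(** The chain condition makes the largest atom met by w refine all others met
    by w: the whole pattern of atoms met is encoded by this single one. *)
Lemma stateP v w :
  state v w \in atoms v /\
  {in atoms v, forall t, refines (state v w) t = satisfies w t}.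
Proof.
rewrite /state; case: arg_maxnP => [|t /andP[tv wt] max_t].
  by rewrite setU11 satisfies_cube0.
split=> // c cv; apply/idP/idP=> [ref_tc|wc]; first exact: satisfies_refines wt.
apply: satisfies_nested (wt) (wc) _.
case/orP: (atoms_nested cv tv) => // sub_tc.
have le_ct : (#|supp c| <= #|supp t|)%N by apply: max_t; rewrite cv.
by have /eqP -> : supp t == supp c by rewrite eqEcard sub_tc.
Qed.

Lemma state_update v w b : state v (update w v b) = state v w.
Proof.
have [sv ref_s] := stateP v w; have [sv' ref_s'] := stateP v (update w v b).
have eq_sat t : t \in atoms v -> satisfies (update w v b) t = satisfies w t.
  by move/atoms_self; apply: satisfies_update.
apply: refines_antisym; rewrite ref_s' // ref_s //; apply/andP; split.
  by rewrite eq_sat // -ref_s ?refines_refl.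
by rewrite -eq_sat // -ref_s' ?refines_refl.
Qed.

(** * Distributions and consistent weights *)

Section Weights.
Variable R : realFieldType.

Implicit Types (mu : point V -> R) (a : V -> cube V -> bool -> R).

(** The triples (v, t, b) whose weights add up to the probability of c: v is the
    first node of c, b its value there, and t runs through the states at v that
    guarantee the tail of c. *)
Definition cell c (p : V * cube V * bool) : bool :=
  [&& first c p.1.1, c p.1.1 == Some p.2 & refines p.1.2 (tail p.1.1 c)].

(** The probability that the weights assign to c; there is no first node to
    read it from when c is empty, hence the constant. *)
Definition cube_weight a c : R :=
  (c == cube0)%:R +
  \sum_(p : V * cube V * bool | (p.1 \in atom_pairs) && cell c p)
    a p.1.1 p.1.2 p.2.

Definition consistent a := forall v, {in atoms v, forall t,
  \sum_(t' in atoms v | refines t' t) (a v t' true + a v t' false) =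
  cube_weight a t}.

Lemma cube_weight0 a : cube_weight a cube0 = 1.
Proof.
rewrite /cube_weight eqxx big_pred0 ?addr0 // => p.
by rewrite /cell (negPf (first_cube0 _)) andbF.
Qed.

Lemma cube_weight_first a c v b : first c v -> c v = Some b ->
  cube_weight a c =
  \sum_(t in atoms v | refines t (tail v c)) a v t b.
Proof.
move=> first_v cv; rewrite /cube_weight.
have /negPf -> : c != cube0.
  by apply: contraTneq first_v => ->; apply: first_cube0.
rewrite add0r (reindex_onto (fun t => (v, t, b)) (fun p => p.1.2)) /=.
  by apply: eq_bigl => t; rewrite inE /cell /= first_v cv !eqxx andbT.
case=> -[u t] b' /= /andP[_ /and3P[/= first_u /eqP cu _]].
have eq_uv := first_uniq first_u first_v.
by move: cu; rewrite eq_uv cv => -[->].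
Qed.

Lemma Pr_state mu v (E : pred (point V)) c : c \in atoms v ->
  Pr mu (fun w => E w && satisfies w c) =
  \sum_(t in atoms v | refines t c) Pr mu (fun w => E w && (state v w == t)).
Proof.
move=> cv; rewrite -Pr_partition => [|w]; last by case: (stateP v w).
by apply: eq_Pr => w; case: (stateP v w) => _ ->.
Qed.

Section Soundness.
Variable mu : point V -> R.
Hypothesis mu_distr : distribution mu.

Definition state_weight v t b :=
  Pr mu (fun w => (w v == b) && (state v w == t)).

Lemma cube_weight_state c : admissible c ->
  cube_weight state_weight c = Pr mu (fun w => satisfies w c).
Proof.
move=> adm_c; case: (cube0_or_first c) => [->|[v first_v [b cv]]].
  rewrite cube_weight0; have [_ <-] := mu_distr.
  by apply: eq_Pr => w; rewrite satisfies_cube0.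
rewrite (cube_weight_first _ first_v cv) -Pr_state.
  by apply: eq_Pr => w; rewrite (satisfies_first w first_v cv) andbC.
exact: (implyP (forallP adm_c v)).
Qed.

Lemma state_weight_consistent : consistent state_weight.
Proof.
move=> v t tv; rewrite cube_weight_state ?(admissible_atom tv) //.
have := Pr_state mu predT tv; rewrite /= => ->.
apply: eq_bigr => t' _; rewrite /state_weight /Pr.
rewrite [RHS](bigID (fun w => w v)) /=; congr (_ + _).
  by apply: eq_bigl => w; rewrite eqb_id andbC.
by apply: eq_bigl => w; rewrite eqbF_neg andbC.
Qed.

End Soundness.

(** Downward induction on the position n: the distribution gives the prescribed
    probability to the admissible cubes supported on positions at least n.  The
    step from n + 1 to n resamples the node v at position n conditionally on its
    state.  The atoms at v live on later positions, so their probabilities are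
    already right, and consistency with inversion gives the law of the state
    needed for resampling. *)
Lemma consistent_realizable a :
    (forall v t b, 0 <= a v t b) -> consistent a ->
  exists2 mu, distribution mu &
    forall c, admissible c -> Pr mu (fun w => satisfies w c) = cube_weight a c.
Proof.
move=> a_ge0 a_cons.
pose agree n mu := distribution mu /\ forall c, admissible c ->
  (forall u, c u -> (n <= pos u)%N) ->
  Pr mu (fun w => satisfies w c) = cube_weight a c.
suff [mu [distr_mu agree_mu]] : exists mu, agree 0%N mu.
  by exists mu => // c adm_c; apply: agree_mu.
pose N := (\max_v pos v).+1.
(* No node has position [N] or more, so only the empty cube is concerned and
   any distribution will do. *)
have agreeN : agree N (fun w => (w == [ffun=> false])%:R).
  have distr : distribution (fun w : point V => (w == [ffun=> false])%:R : R).
    split=> [w|]; first exact: ler0n.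
    rewrite /Pr (bigD1 [ffun=> false]) //= eqxx big1 ?addr0 // => w.
    by case: eqP.
  split=> // c _ posc; case: (cube0_or_first c) => [->|[v /andP[/posc]]].
    rewrite cube_weight0 -[RHS]distr.2; apply: eq_Pr => w.
    by rewrite satisfies_cube0.
  by rewrite /N ltnNge leq_bigmax.
have step n : (exists mu, agree n.+1 mu) -> exists mu, agree n mu.
  case=> mu [[mu_ge0 mu1] agree_mu].
  have [/existsP[v /eqP pos_v]|no_v] := boolP [exists v, pos v == n];
    last first.
    exists mu; split=> // c adm_c posc; apply: agree_mu => // u cu.
    rewrite ltn_neqAle posc // andbT; apply: contra no_v => /eqP ->.
    by apply/existsP; exists u.
  have Pr_st : {in atoms v, forall t,
      Pr mu (fun w => state v w == t) = a v t true + a v t false}.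
    apply: (eq_of_down_sums (@refines_refl V) (@refines_antisym V)
              (@refines_trans V)) => t tv.
    rewrite a_cons // -agree_mu ?(admissible_atom tv) //.
      by have := Pr_state mu predT tv; rewrite /= => ->.
    move=> u; case/setU1P: tv => [->|/imsetP[i _ ->]]; rewrite ffunE //.
    by rewrite -pos_v; case: ifP.
  have [mu' [mu'_ge0 mu'_inv mu'_st]] := resample mu_ge0 (a_ge0 v)
    (fun w => (stateP v w).1) (state_update v) Pr_st.
  exists mu'; split=> [|c adm_c posc].
    by split=> //; rewrite mu'_inv.
  have [cv|ncv] := boolP (c v); last first.
    rewrite mu'_inv => [|w b]; last by rewrite satisfies_update.
    apply: agree_mu => // u cu; rewrite ltn_neqAle posc // andbT -pos_v.
    by apply: contraNneq ncv => /pos_inj ->.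
  have first_v : first c v.
    by rewrite /first cv; apply/forallP=> u; rewrite pos_v; apply/implyP/posc.
  case Ec: (c v) cv => [b|] // _.
  rewrite (cube_weight_first a first_v Ec).
  have tv := implyP (forallP adm_c v) first_v.
  under eq_bigr => t /andP[tv' _] do rewrite -mu'_st //.
  rewrite -Pr_state //; apply: eq_Pr => w.
  by rewrite (satisfies_first w first_v Ec) andbC.
have: exists mu, agree N mu by eexists; exact: agreeN.
by elim: (N) => // n IHn /step.
Qed.

End Weights.
End CubeFamily.
(** * The linear system *)

Section CubePolytope.
Variables (R : realFieldType) (V I : finType).
Variables (pos : V -> nat) (q : I -> cube V).

Definition cube_points (z : {ffun I -> R^o}) : Prop :=
  exists w : point V, forall i, z i = (satisfies w (q i))%:R.

Lemma cube_hullP (z : {ffun I -> R^o}) :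
  convex_hull cube_points z <->
  exists2 mu : point V -> R, distribution mu &
    forall i, z i = Pr mu (fun w => satisfies w (q i)).
Proof.
split=> [[n [c [u [c_ge0 c1 ptu ->]]]] | [mu [mu_ge0 mu1] zE]].
  have [w wE] := fin_all_exists ptu.
  exists (fun w0 => \sum_(j | w j == w0) c j).
    split=> [w0|]; first exact: sumr_ge0.
    by rewrite -c1 [RHS](partition_big w predT).
  move=> i; rewrite sum_ffunE /Pr.
  rewrite (partition_big w predT) //= [RHS]big_mkcond; apply: eq_bigr => w0 _.
  case: ifP => sat_w0; last first.
    by rewrite big1 // => j /eqP eq_w; rewrite ffunE wE eq_w sat_w0 scaler0.
  by apply: eq_bigr => j /eqP eq_w; rewrite ffunE wE eq_w sat_w0; apply: mulr1.
pose u w : {ffun I -> R^o} := [ffun i => (satisfies w (q i))%:R].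
exists #|point V|, (fun j => mu (enum_val j)), (fun j => u (enum_val j)).
split=> // [|j|]; [|by exists (enum_val j) => i; rewrite ffunE|].
  by rewrite -(big_enum_val mu) -mu1; apply: eq_bigl.
rewrite -(big_enum_val (fun w => mu w *: u w)); apply/ffunP=> i.
  rewrite zE sum_ffunE /Pr [LHS]big_mkcond; apply: eq_bigr => w _.
  by rewrite !ffunE; case: ifP => _; rewrite ?scaler0 //; apply/esym/mulr1.
Qed.

Notation atom_pairs := (atom_pairs pos q).

Definition weight_index : finType :=
  {p : V * cube V * bool | p.1 \in atom_pairs}.
Notation X := (I + weight_index)%type.

(** Each coefficient is a difference of two indicators, hence 0, 1 or -1 even
    when P and N overlap. *)
Definition signed_sum (P N : {set X}) (b : R) : lin_constraint R X :=
  ([ffun k => (k \in P)%:R - (k \in N)%:R], b).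

Lemma lin_form_signed_sum P N b x :
  lin_form (signed_sum P N b).1 x = \sum_(k in P) x k - \sum_(k in N) x k.
Proof.
rewrite /lin_form [in RHS]big_mkcond [X in _ - X]big_mkcond -sumrB.
apply: eq_bigr => k _; rewrite ffunE mulrBl.
by do 2!case: (k \in _); rewrite ?mul0r ?mul1r.
Qed.

Definition weights (Q : pred (V * cube V * bool)) : {set X} :=
  [set k : X | if k is inr y then Q (val y) else false].

Definition nonnegativity (y : weight_index) :=
  signed_sum set0 [set inr y] 0.
Definition readout (i : I) :=
  signed_sum [set inl i] (weights (cell pos (q i))) (q i == cube0)%:R.
Definition additivity (p : V * cube V) :=
  signed_sum (weights (fun p' => (p'.1.1 == p.1) && refines p'.1.2 p.2))
    (weights (cell pos p.2)) (p.2 == cube0)%:R.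

Definition cube_system : lin_system R X :=
  LinSystem [seq nonnegativity y | y <- enum weight_index]
    ([seq readout i | i <- enum I] ++
     [seq additivity p | p <- enum atom_pairs]).

(** The additional variables as a total function of the triples, so that the
    results on weights apply without dependent indices. *)
Definition weight_of (x : {ffun X -> R^o}) v t b : R :=
  if insub (v, t, b) is Some y then x (inr y) else 0.

Lemma sum_weights (x : {ffun X -> R^o}) Q :
  \sum_(k in weights Q) x k =
  \sum_(p | (p.1 \in atom_pairs) && Q p) weight_of x p.1.1 p.1.2 p.2.
Proof.
rewrite big_sumType /= big_pred0 => [|i]; last by rewrite inE.
rewrite add0r (big_sub_cond (fun p => p.1 \in atom_pairs) Q).
apply: eq_big => [y|y _]; first by rewrite inE.
by rewrite /weight_of; case: y => -[[v t] b] py /=; rewrite insubT.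
Qed.

Lemma sum_weights_below (x : {ffun X -> R^o}) v t :
  \sum_(k in weights (fun p => (p.1.1 == v) && refines p.1.2 t)) x k =
  \sum_(t' in atoms pos q v | refines t' t)
    (weight_of x v t' true + weight_of x v t' false).
Proof.
rewrite sum_weights.
under [RHS]eq_bigr => t' _ do rewrite -(big_bool _ (weight_of x v t')).
rewrite pair_big_dep /=.
rewrite (reindex_onto (fun p : cube V * bool => (v, p.1, p.2))
   (fun p => (p.1.2, p.2))) /=; last first.
  by case=> -[u t'] b /= /and3P[_ /eqP-> _].
apply: eq_bigl => -[t' b] /=; rewrite inE /= !eqxx /=.
by rewrite !andbT.
Qed.

Lemma solution_cube_systemP x :
  solution cube_system x <->
  [/\ forall v t b, 0 <= weight_of x v t b,
      forall i, x (inl i) = cube_weight pos q (weight_of x) (q i)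
    & consistent pos q (weight_of x)].
Proof.
have weightE c : cube_weight pos q (weight_of x) c =
    (c == cube0)%:R + \sum_(k in weights (cell pos c)) x k.
  by rewrite sum_weights.
split=> [[ineqP eqnP] | [x_ge0 x_read x_cons]].
  split=> [v t b|i|v t tv].
  - rewrite /weight_of; case: insubP => [y _ _|//].
    have /ineqP : nonnegativity y \in ineqs cube_system.
      by apply: map_f; rewrite mem_enum.
    by rewrite lin_form_signed_sum big_set0 big_set1 sub0r oppr_le0.
  - have /eqnP : readout i \in eqns cube_system.
      by rewrite mem_cat map_f ?mem_enum // inE.
    by rewrite lin_form_signed_sum big_set1 weightE /= => <-; rewrite subrK.
  - have /eqnP : additivity (v, t) \in eqns cube_system.
      by rewrite mem_cat orbC map_f // mem_enum inE.
    rewrite lin_form_signed_sum sum_weights_below weightE /= => <-.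
    by rewrite subrK.
split=> c.
  case/mapP=> y _ ->.
  rewrite lin_form_signed_sum big_set0 big_set1 sub0r oppr_le0.
  have := x_ge0 (val y).1.1 (val y).1.2 (val y).2.
  by rewrite /weight_of -!surjective_pairing valK.
rewrite mem_cat => /orP[] /mapP[p].
  by move=> _ ->; rewrite lin_form_signed_sum big_set1 x_read weightE addrK.
rewrite mem_enum inE => pP ->.
by rewrite lin_form_signed_sum sum_weights_below x_cons // weightE addrK.
Qed.

Lemma data_cube_system : data_0_pm1 cube_system.
Proof.
have data P N b : in_0_pm1 b -> let c := signed_sum P N b in
    (forall k, in_0_pm1 (c.1 k)) /\ in_0_pm1 c.2.
  move=> bP; split=> // k; rewrite ffunE /in_0_pm1 !inE.
  by do 2!case: (k \in _); rewrite ?subrr ?subr0 ?sub0r ?eqxx ?orbT.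
have bool_data (b : bool) : in_0_pm1 (b%:R : R).
  by case: b; rewrite /in_0_pm1 !inE eqxx ?orbT.
move=> c; rewrite !mem_cat => /or3P[] /mapP[k _ ->]; apply: data => //.
by rewrite /in_0_pm1 inE eqxx.
Qed.

Lemma card_weight_index : #|weight_index| = (#|atom_pairs| * 2)%N.
Proof.
rewrite card_sig -card_bool -cardsT -cardsX.
by rewrite cardE -cardE; apply: eq_card => p; rewrite !inE andbT.
Qed.

Lemma size_ineqs_cube_system : size (ineqs cube_system) = (#|atom_pairs| * 2)%N.
Proof. by rewrite size_map -cardE card_weight_index. Qed.

Lemma size_eqns_cube_system :
  size (eqns cube_system) = (#|I| + #|atom_pairs|)%N.
Proof. by rewrite size_cat; congr (_ + _)%N; rewrite size_map -cardE. Qed.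

Lemma card_atom_pairs m :
  (forall v, (#|[set i | q i v]| <= m)%N) -> (#|atom_pairs| <= #|V| * m.+1)%N.
Proof.
move=> le_m; rewrite -sum1_card (partition_big (fun p => p.1) predT) //=.
rewrite -sum_nat_const; apply: leq_sum => v _.
rewrite sum1_card; apply: (@leq_trans #|atoms pos q v|).
  have pair_inj : injective (fun t : cube V => (v, t)) by move=> t t' [].
  rewrite -(card_imset (mem (atoms pos q v)) pair_inj).
  apply: subset_leq_card; apply/subsetP=> -[u t]; case/andP=> /= tv /eqP <-.
  by apply: imset_f; rewrite inE in tv.
rewrite /atoms cardsU1 -add1n leq_add ?leq_b1 //.
apply: leq_trans (leq_imset_card _ _) (leq_trans _ (le_m v)).
by apply/subset_leq_card/subsetP=> i; rewrite !inE.
Qed.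

Hypothesis pos_inj : injective pos.
Hypothesis nested : forall v i j, q i v -> q j v ->
  (supp (tail pos v (q i)) \subset supp (tail pos v (q j))) ||
  (supp (tail pos v (q j)) \subset supp (tail pos v (q i))).

Lemma cube_system_formulation :
  extended_formulation cube_system (convex_hull cube_points).
Proof.
move=> z; apply: (iff_trans (cube_hullP z)); split=> [[mu mu_distr zE]|[x]].
  pose a := state_weight pos q mu.
  pose x : {ffun X -> R^o} := [ffun k => match k with
    | inl i => z i | inr y => a (val y).1.1 (val y).1.2 (val y).2 end].
  have xE v t b : t \in atoms pos q v -> weight_of x v t b = a v t b.
    move=> tv; rewrite /weight_of insubT => [|?]; first by rewrite inE.
    by rewrite ffunE.
  have weightE c : cube_weight pos q (weight_of x) c = cube_weight pos q a c.
    by congr (_ + _); apply: eq_bigr => p /andP[]; rewrite inE => /xE ->.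
  exists x => [|i]; last by rewrite ffunE.
  apply/solution_cube_systemP; split=> [v t b|i|v t tv].
  - rewrite /weight_of; case: insubP => // y _ _; rewrite ffunE.
    by apply: Pr_ge0; case: mu_distr.
  - rewrite ffunE weightE zE cube_weight_state //; exact: admissible_family.
  - rewrite weightE -(state_weight_consistent pos_inj nested mu_distr tv).
    by apply: eq_bigr => t' /andP[tv' _]; rewrite !xE.
case/solution_cube_systemP=> x_ge0 x_read x_cons zE.
have [mu mu_distr muE] := consistent_realizable pos_inj nested x_ge0 x_cons.
exists mu => // i; rewrite -zE x_read muE //; exact: admissible_family.
Qed.

End CubePolytope.
(** * Beta-acyclic hypergraphs *)

(** When the turn of v comes, the edges through v are e and f without the nodes
    already eliminated, and v being a beta-leaf makes them comparable. *)
Lemma beta_elimination_nested (T : finType) (G : hypergraph T) (vs : seq T) v :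
    beta_elimination G vs -> v \in vs ->
  forall e f, e \in edges G -> f \in edges G -> v \in e -> v \in f ->
  let later := [set u | (index v vs < index u vs)%N] in
  (e :&: later \subset f :&: later) || (f :&: later \subset e :&: later).
Proof.
elim: vs G => [//|v0 vs IHvs] G /= /andP[/andP[_ leaf] elim_vs] v_in.
move=> e f eG fG ve vf.
have [eq_v0v|neq_v0v] := eqVneq v0 v.
  have := forall_inP (forall_inP leaf e eG) f fG.
  by rewrite eq_v0v ve vf => /orP[] /setSI->; rewrite ?orbT.
have {}v_in : v \in vs by move: v_in; rewrite inE eq_sym (negPf neq_v0v).
have edge_del g : g \in edges G -> v \in g -> g :\ v0 \in edges (del_node G v0).
  move=> gG vg; apply: imset_f; rewrite inE gG card_gt0.
  by apply/set0Pn; exists v; rewrite !inE vg andbT eq_sym.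
have v_del (g : {set T}) : v \in g -> v \in g :\ v0.
  by rewrite !inE eq_sym neq_v0v.
have := IHvs _ elim_vs v_in _ _ (edge_del e eG ve) (edge_del f fG vf)
  (v_del e ve) (v_del f vf).
(* The node [v0] gets index 0, so it is never later than [v]; after its removal
   it has an index beyond [vs], but it is no longer in the edges. *)
have restrict (g : {set T}) :
    g :&: [set u | (index v vs).+1 < if v0 == u then 0 else (index u vs).+1]%N =
    (g :\ v0) :&: [set u | (index v vs < index u vs)%N].
  by apply/setP=> u; rewrite !inE (eq_sym u); case: (v0 == u); rewrite ?andbF.
by rewrite !restrict.
Qed.

(** * Pseudo-Boolean sets as families of cubes *)

Section PseudoBoolean.
Variables (V : finType) (H : signed_hypergraph V).

Definition literal_cube (i : pb_index H) : cube V :=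
  match i with
  | inl v => [ffun u => if u == v then Some true else None]
  | inr s => [ffun u => omap (sign_of (val s)) (insub u)]
  end.

Lemma literal_cube_inr (s : {s | s \in sedges H}) v :
  literal_cube (inr s) v = (v \in edge_of (val s)) :> bool.
Proof. by rewrite ffunE; case: insubP => [u -> _|/negPf ->]. Qed.

Lemma literal_cube_inl u v : literal_cube (inl u) v = (v == u) :> bool.
Proof. by rewrite ffunE; case: eqP. Qed.

Lemma satisfies_inl w v : satisfies w (literal_cube (inl v)) = w v.
Proof.
apply/satisfiesP/idP=> [wc|wv u b]; first by apply: wc; rewrite ffunE eqxx.
by rewrite ffunE; case: eqP => // -> [<-].
Qed.

Lemma satisfies_inr (R : realFieldType) w (s : {s | s \in sedges H}) :
  (satisfies w (literal_cube (inr s)))%:R =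
  \prod_(v : {v | v \in edge_of (val s)})
     literal (fun u => (w u)%:R : R) v.
Proof.
have litE (v : {v | v \in edge_of (val s)}) :
    literal (fun u => (w u)%:R) v = (w (val v) == sign_of (val s) v)%:R :> R.
  rewrite /literal; case: (sign_of _ _); case: (w _) => //=.
    by rewrite subrr.
  by rewrite subr0.
under eq_bigr do rewrite litE.
have [/satisfiesP wc|] := boolP (satisfies _ _).
  rewrite big1 // => v _; rewrite (wc _ (sign_of (val s) v)) ?eqxx //.
  by rewrite ffunE valK.
rewrite negb_forall => /existsP[u].
rewrite !ffunE; case: insubP => [v _ <-|_] //=.
move=> neq_v; have /negPf w_v : w (val v) != sign_of (val s) v.
  by apply: contra neq_v => /eqP <-.
by rewrite (bigD1 v) //= w_v mul0r.
Qed.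

Lemma pseudo_boolean_setP (R : realFieldType) (z : {ffun pb_index H -> R^o}) :
  pseudo_boolean_set z <-> cube_points literal_cube z.
Proof.
split=> [[z01 zs]|[w zE]].
  have z_inl v : z (inl v) = (z (inl v) == 1)%:R.
    by case: (z01 (inl v)) => ->; rewrite ?eqxx // eq_sym oner_eq0.
  exists [ffun v => z (inl v) == 1] => -[v|s].
    by rewrite satisfies_inl ffunE -z_inl.
  rewrite zs satisfies_inr; apply: eq_bigr => v _.
  by rewrite /literal ffunE -z_inl.
split=> [i|s]; first by rewrite zE; case: satisfies; [right|left].
rewrite zE satisfies_inr; apply: eq_bigr => v _.
by rewrite /literal zE satisfies_inl.
Qed.

(** The cube of a node has an empty tail after that node, so only pairs of
    signed edges matter, and parallel edges have equal supports. *)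
Lemma literal_cube_nested (vs : seq V) :
    perm_eq vs (enum [set: V]) -> beta_elimination (underlying H) vs ->
  let pos v := index v vs in
  forall v i j, literal_cube i v -> literal_cube j v ->
  (supp (tail pos v (literal_cube i)) \subset
   supp (tail pos v (literal_cube j)))
  || (supp (tail pos v (literal_cube j)) \subset
      supp (tail pos v (literal_cube i))).
Proof.
move=> vs_perm elim_vs pos v i j.
have node_empty u : literal_cube (inl u) v ->
    supp (tail pos v (literal_cube (inl u))) = set0.
  rewrite literal_cube_inl => /eqP <-; apply/setP=> x; rewrite !inE ffunE.
  case: ifP => // lt_vx; rewrite literal_cube_inl.
  by apply: contraTF lt_vx => /eqP ->; rewrite ltnn.
have edge_supp s : supp (tail pos v (literal_cube (inr s))) =
    edge_of (val s) :&: [set u | (pos v < pos u)%N].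
  apply/setP=> x; rewrite !inE ffunE; case: ifP => _; rewrite ?andbF //.
  by rewrite literal_cube_inr andbT.
have edgeP (s : {s | s \in sedges H}) :
    edge_of (val s) \in edges (underlying H).
  by apply: imset_f; apply: valP.
case: i j => [u|s] [u'|s'] vi vj; rewrite ?(node_empty _ vi) ?(node_empty _ vj)
  ?sub0set ?orbT //.
rewrite !literal_cube_inr in vi vj; rewrite !edge_supp.
apply: (beta_elimination_nested elim_vs) => //.
by rewrite (perm_mem vs_perm) mem_enum inE.
Qed.

Lemma card_literal_cubes v :
  (#|[set i | literal_cube i v]| <= #|sedges H|.+1)%N.
Proof.
have sub_i : [set i | literal_cube i v] \subset
    inl v |: [set inr s | s in predT].
  apply/subsetP=> -[u|s]; rewrite !inE; last by rewrite imset_f ?orbT.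
  by rewrite literal_cube_inl => /eqP ->; rewrite eqxx.
apply: leq_trans (subset_leq_card sub_i) _.
rewrite cardsU1 -add1n leq_add ?leq_b1 //.
by apply: leq_trans (leq_imset_card _ _) _; rewrite card_sig.
Qed.

End PseudoBoolean.

Lemma convex_hull_ext (R : numDomainType) (E : lmodType R) (A B : E -> Prop) x :
  (forall y, A y <-> B y) -> convex_hull A x <-> convex_hull B x.
Proof.
move=> eqAB; split=> -[n [w [u [w_ge0 w1 Au ->]]]];
  by exists n, w, u; split=> // i; apply/eqAB.
Qed.

Theorem theorem5 :
  exists p : {poly {poly nat}},
  forall (R : realFieldType) (V : finType) (H : signed_hypergraph V) (r : nat),
    has_rank H r ->
    beta_acyclic (underlying H) ->
    exists (Y : finType) (F : lin_system R (pb_index H + Y)%type),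
      [/\ extended_formulation F (@pseudo_boolean_polytope V H R),
          (#|{: pb_index H + Y}| <= p.[#|V|%:P].[#|sedges H|])%N
            /\ (n_constraints F <= p.[#|V|%:P].[#|sedges H|])%N,
          (#|{: pb_index H + Y}| <= 2 * r * (2 * #|sedges H| + 1) * #|V|)%N,
          (size (ineqs F) <= 4 * r * (2 * #|sedges H| + 1) * #|V|)%N
        & data_0_pm1 F].
Proof.
(* There are at most [|V| (|S| + 2)] pairs of a node and an atom; each gives two
   variables, two inequalities and one equation. *)
pose p : {poly {poly nat}} := 'X%:P + 'X * (3%:R * 'X + 7%:R)%:P.
have pE n m : p.[n%:P].[m] = (m + n * (3 * m + 7))%N.
  by rewrite /p !(hornerD, hornerM, hornerX, hornerC, hornerMn).
exists p => R V H r [[s sH rank_s] _] [vs vs_perm elim_vs].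
pose pos v := index v vs; pose q := @literal_cube V H.
have pos_inj : injective pos.
  have in_vs u : u \in vs by rewrite (perm_mem vs_perm) mem_enum inE.
  by move=> u v; apply: (index_inj u (in_vs u) (in_vs v)).
pose F := cube_system R pos q.
have formulation : extended_formulation F (convex_hull (cube_points q)).
  exact: cube_system_formulation pos_inj (literal_cube_nested vs_perm elim_vs).
have r_ge2 : (2 <= r)%N by rewrite -rank_s; apply: (forall_inP (sedges_wf H)).
have S_gt0 : (0 < #|sedges H|)%N by apply/card_gt0P; exists s.
have V_gt0 : (0 < #|V|)%N.
  by apply: leq_trans (max_card (mem (edge_of s))); rewrite rank_s ltnW.
have le_pairs : (#|atom_pairs pos q| <= #|V| * #|sedges H|.+2)%N.
  exact: card_atom_pairs (@card_literal_cubes V H).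
have le_r : (2 * ((2 * #|sedges H| + 1) * #|V|) <=
              r * ((2 * #|sedges H| + 1) * #|V|))%N.
  by rewrite leq_mul2r r_ge2 orbT.
have card_pb : #|pb_index H| = (#|V| + #|sedges H|)%N.
  by apply: etrans (card_sum _ _) _; rewrite card_sig.
have cardX : #|{: pb_index H + weight_index pos q}| =
    (#|V| + #|sedges H| + #|atom_pairs pos q| * 2)%N.
  by rewrite card_sum card_pb card_weight_index.
have := size_ineqs_cube_system R pos q.
have := size_eqns_cube_system R pos q; rewrite card_pb -/F => n_eqns n_ineqs.
exists (weight_index pos q), F; split.
- move=> z; apply: iff_trans (formulation z); apply: convex_hull_ext.
  exact: pseudo_boolean_setP.
- by rewrite cardX /n_constraints n_ineqs n_eqns pE; split; nia.
- rewrite cardX -mulnA -mulnA; nia.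
- rewrite n_ineqs; nia.
- exact: data_cube_system.
Qed.
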